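(* Let $m$ be a positive integer and let $a_1,a_2,K$ be integers with $0\le a_1,a_2,K\le m-1$. Then $$S_m(\{a_1,a_2\},K)\le\left\lfloor\frac{m}{2}\right\rfloor.$$
   Context: For a positive integer $m$ and non-negative integers $a_1,a_2,K$ (with $a_1=a_2$ allowed; $\{a_1,a_2\}$ is just a list of parameters), define $$S_m(\{a_1,a_2\},K)=\sum_{k=0}^K\left(\left\lfloor\frac{a_1+a_2+k}{m}\right\rfloor-\left\lfloor\frac{a_1+k}{m}\right\rfloor-\left\lfloor\frac{a_2+k}{m}\right\rfloor+\left\lfloor\frac{k}{m}\right\rfloor\right).$$ *)

(* Defs.v *)
From mathcomp Require Import all_boot all_order all_algebra.
Set Implicit Arguments.
Unset Strict Implicit.
Unset Printing Implicit Defensive.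
Import Order.TTheory GRing.Theory Num.Theory.
Local Open Scope ring_scope.

(* For natural numbers and m > 0, [%/] is the floor of the quotient. The
   quotients are cast to [int] before being combined, since a summand may be
   negative and subtraction on [nat] is truncated. *)
Definition S2 (m a1 a2 K : nat) : int :=
  \sum_(0 <= k < K.+1)
    (((a1 + a2 + k) %/ m)%N%:Z - ((a1 + k) %/ m)%N%:Z
     - ((a2 + k) %/ m)%N%:Z + (k %/ m)%N%:Z).

(* Main.v *)
Require Import Defs.
From mathcomp Require Import all_boot all_order all_algebra zify.
Set Implicit Arguments.
Unset Strict Implicit.
Unset Printing Implicit Defensive.
Import Order.TTheory GRing.Theory Num.Theory.
Local Open Scope ring_scope.

(** Each of the four sums of floors counts pairs [(j, k)] with [0 <= k <= K] and
    [j m <= c + k], which gives a closed form piecewise linear in [a1], [a2],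
    [K]. The resulting expression is at most [min a1 a2] when [a1 + a2 <= m], and
    at most [m - max a1 a2] otherwise; both are at most [m / 2]. *)

(* The truncated subtractions are intended: [k] ranges over [k >= 0], so a
   threshold [j m - c] below [0] acts as [0]. *)
Lemma sum_divn_add (m c N : nat) : (c < 2 * m)%N -> (N <= m)%N ->
  (\sum_(0 <= k < N) (c + k) %/ m = (N - (m - c)) + (N - (2 * m - c)))%N.
Proof.
move=> lt_c_2m; elim: N => [|N IHN] le_N_m; first by rewrite big_nil.
rewrite big_nat_recr //= IHN; last exact: ltnW.
(* Since [c < 2 * m] and [N < m], the quotient is at most 2, so it counts which of the thresholds
   [m] and [2 * m] are reached by [c + N]. *)
have -> : ((c + N) %/ m = (m <= c + N) + (2 * m <= c + N))%N.
  have m_gt0 : (0 < m)%N by lia.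
  move: (leq_divRL 1 (c + N) m_gt0) (leq_divRL 2 (c + N) m_gt0).
  move: (leq_divRL 3 (c + N) m_gt0).
  move: ((c + N) %/ m)%N => q; lia.
lia.
Qed.

Theorem corollary8 (m a1 a2 K : nat) (hm : (0 < m)%N)
    (ha1 : (a1 <= m - 1)%N) (ha2 : (a2 <= m - 1)%N) (hK : (K <= m - 1)%N) :
  S2 m a1 a2 K <= (m %/ 2)%N%:Z.
Proof.
rewrite /S2 big_split /= !sumrB -!(big_morph Posz PoszD (erefl 0%:Z)).
(* Reading [k] as [0 + k] gives the last sum the shape of the other three, with shift [0]. *)
rewrite -[X in _ + Posz X](eq_bigr _ (fun k _ => congr1 (divn^~ m) (add0n k))).
rewrite (@sum_divn_add m (a1 + a2)); [|lia|lia].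
rewrite (@sum_divn_add m a1); [|lia|lia].
rewrite (@sum_divn_add m a2); [|lia|lia].
rewrite (@sum_divn_add m 0); [|lia|lia].
(* Here [K.+1 <= m <= 2 * m - c]: the threshold [2 * m] can matter only for the shift [a1 + a2], the
   only one that may exceed [m]. *)
have vanish c : (c <= m)%N -> (K.+1 - (2 * m - c) = 0)%N by lia.
rewrite (vanish 0) ?(vanish a1) ?(vanish a2); lia.
Qed.
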